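(* For every ${\bf\Sigma}^1_1$ (analytic) set $A\subseteq\omega^\omega$, either there exists a Hechler tree $H$ with $[H]\cap A=\emptyset$, or there exists a Laver tree $L$ with $[L]\subseteq A$.
   Context: A subtree of $\omega^{<\omega}$ is a nonempty subset closed under initial segments. For $s\in\omega^{<\omega}$ and $n\in\omega$, $sn$ denotes the one-term extension of $s$ by $n$. A subtree $H\subseteq\omega^{<\omega}$ is Hechler iff for every $s\in H$, $sn\in H$ for all but finitely many $n\in\omega$. A subtree $L\subseteq\omega^{<\omega}$ is Laver iff for every $s\in L$, $sn\in L$ for infinitely many $n\in\omega$. For a subtree $T$, $[T]=\{x\in\omega^\omega: \forall n\ x\upharpoonright n\in T\}$. *)

(* Defs.v *)
From mathcomp Require Import all_boot.
From mathcomp Require Import boolp classical_sets functions cardinality topology.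

Set Implicit Arguments.
Unset Strict Implicit.
Unset Printing Implicit Defensive.

Local Open Scope classical_set_scope.

(* [nat] carries the discrete topology, so this is Baire space. *)
Definition baire : topologicalType := {ptws nat -> nat}.

(* Boldface Sigma^1_1. *)
Definition analytic (A : set baire) : Prop :=
  exists2 C : set (baire * baire), closed C & A = fst @` C.

Definition subtree (T : set (seq nat)) : Prop :=
  T !=set0 /\ (forall s t : seq nat, prefix s t -> T t -> T s).

Definition hechler (H : set (seq nat)) : Prop :=
  subtree H /\ (forall s, H s -> finite_set [set n | ~ H (rcons s n)]).

Definition laver (L : set (seq nat)) : Prop :=
  subtree L /\ (forall s, L s -> infinite_set [set n | L (rcons s n)]).

Definition branches (T : set (seq nat)) : set baire :=
  [set x : baire | forall n, T (mkseq x n)].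

(* Main.v *)
Require Import Defs.
From mathcomp Require Import all_boot.
From mathcomp Require Import boolp classical_sets functions cardinality topology.

(** Write [A] as the projection of a closed set [C], and call a pair of finite
    sequences [(s, t)] avoidable when some Hechler tree above [s] misses the
    projection of the part of [C] lying over [t].  If the empty pair is avoidable
    we have the tree [H].  Otherwise, a diagonal intersection of countably many Hechler
    trees shows that from an unavoidable [(s, t)] one can, by a well-founded
    process branching infinitely often at each step, reach unavoidable pairs
    [(s', rcons t m)] with [s'] properly extending [s].  Iterating this process
    builds a Laver tree together with a witness [y] along each of its branches,
    and [C] being closed, each branch is in [A]. *)

Local Open Scope classical_set_scope.

Lemma unbounded_infinite (N : set nat) :
  (forall b, exists n, b <= n /\ N n) -> infinite_set N.
Proof.
move=> unbN /finite_seqP [s Ns].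
have [n [ltn Nn]] := unbN (\max_(i <- s) i).+1.
move: Nn; rewrite Ns /= => ns.
by move: ltn; rewrite ltnNge (leq_bigmax_seq (F := id)).
Qed.

Lemma prefix_cvg (u : nat -> baire) (x : baire) :
  (forall j i, i < j -> u j i = x i) -> u @ \oo --> x.
Proof.
move=> ux; apply/pointwise_cvgP => i U Ux; exists i.+1 => // j /= lij.
by rewrite ux //; apply: nbhs_singleton.
Qed.

(** Points of [C] agreeing with [x] and [y] on ever longer prefixes converge to [(x, y)]. *)
Lemma closed_prefix_limit (C : set (baire * baire)) (x y : baire) :
  closed C ->
  (forall j, exists x' y' : baire, [/\ C (x', y'),
     (forall i, i < j -> x' i = x i) & (forall i, i < j -> y' i = y i)]) ->
  C (x, y).
Proof.
move=> clC /choice [u /choice [v uv]].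
have cu : u @ \oo --> x by apply: prefix_cvg => j; have [_ + _] := uv j; apply.
have cv : v @ \oo --> y by apply: prefix_cvg => j; have [_ _ +] := uv j; apply.
apply: (@closed_cvg _ _ \oo _ (fun j => (u j, v j)) C clC _ (x, y)).
  by apply: nearW => j; have [] := uv j.
apply: (@cvg_pair _ _ _ _ (nbhs x) (nbhs y)) => //.
Qed.

Section Dichotomy.
Variable C : set (baire * baire).

(* The Hechler tree is given by a function [k] bounding the forbidden successors. *)
Definition avoidable (s t : seq nat) : Prop :=
  exists k : seq nat -> nat, forall x y : baire,
    mkseq x (size s) = s -> mkseq y (size t) = t ->
    (forall i, size s <= i -> k (mkseq x i) <= x i) -> ~ C (x, y).

Lemma unavoidable_point s t : ~ avoidable s t ->
  exists x y : baire,
    [/\ C (x, y), mkseq x (size s) = s & mkseq y (size t) = t].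
Proof.
move=> nav; apply: contrapT => no; apply: nav.
by exists (fun=> 0) => x y xs yt _ Cxy; apply: no; exists x, y.
Qed.

(** The sequences obeying [k] at every position form the tree: a node [s] loses at most the
    successors below [k s]. *)
Lemma avoidable_hechler : avoidable [::] [::] ->
  exists2 H, hechler H & branches H `&` (fst @` C) = set0.
Proof.
move=> [k kP].
exists [set u | forall i, i < size u -> k (take i u) <= nth 0 u i].
  split; first split.
  - by exists [::].
  - move=> s _ /prefixP [t ->] /= Hst i lis.
    have := Hst i; rewrite size_cat nth_cat lis takel_cat ?(ltnW lis)//; apply.
    exact: ltn_addr.
  - move=> s Hs; apply: (@sub_finite_set _ _ `I_(k s)); last exact: finite_II.
    move=> n /= nH; rewrite ltnNge; apply/negP => lkn; apply: nH => i.
    rewrite size_rcons ltnS leq_eqVlt => /orP [/eqP ->|lis].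
      by rewrite -cats1 take_size_cat// nth_cat ltnn subnn.
    by rewrite -cats1 takel_cat ?(ltnW lis)// nth_cat lis; apply: Hs.
rewrite -subset0 => x [/= Hx [[x' y] Cxy /= xx]]; subst x'.
apply: (kP x y) Cxy => // i _.
have := Hx i.+1 i; rewrite size_mkseq nth_mkseq//.
by rewrite mkseqS -cats1 take_size_cat ?size_mkseq//; apply.
Qed.

(** The moves at which the witness can grow by one term. *)
Definition commits (s t : seq nat) (n : nat) : Prop :=
  exists m, ~ avoidable (rcons s n) (rcons t m).

(* Type-valued, so that the well-founded process can be run by recursion on it. *)
Inductive escape (t s : seq nat) : Type :=
  Escape (N : set nat)
    of (forall b, exists n, b <= n /\ (commits s t n \/ N n))
    & (forall n, N n -> escape t (rcons s n)).

(** Otherwise the successors that commit or have an escape are unbounded, and they assemble into an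
    escape from [s]. *)
Lemma no_escape t s : ~ inhabited (escape t s) ->
  exists b, forall n, b <= n ->
    ~ commits s t n /\ ~ inhabited (escape t (rcons s n)).
Proof.
move=> nE; apply: contrapT => nb; apply: nE.
constructor; apply: (@Escape t s [set n | inhabited (escape t (rcons s n))]).
  move=> b; apply: contrapT => nn; apply: nb; exists b => n lbn.
  by split=> Q; apply: nn; exists n; split=> //; [left|right].
by move=> n En; apply: inhabited_witness.
Qed.

Lemma unavoidable_escape s t : ~ avoidable s t -> inhabited (escape t s).
Proof.
move=> nav; apply: contrapT => nE; apply: nav.
have /choice [b bP] : forall u, exists c,
    ~ inhabited (escape t u) -> forall n, c <= n ->
    ~ commits u t n /\ ~ inhabited (escape t (rcons u n)).
  move=> u; have [E|/no_escape [c cP]] := pselect (inhabited (escape t u)).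
    by exists 0.
  by exists c.
(* One bounding function for each node [p.1] and each possible next term [p.2] of the witness. *)
have /choice [k kP] : forall p : seq nat * nat, exists c : seq nat -> nat,
    avoidable p.1 (rcons t p.2) -> forall x y : baire,
    mkseq x (size p.1) = p.1 ->
    mkseq y (size (rcons t p.2)) = rcons t p.2 ->
    (forall i, size p.1 <= i -> c (mkseq x i) <= x i) -> ~ C (x, y).
  move=> p; have [[c cP]|nav] := pselect (avoidable p.1 (rcons t p.2)).
    by exists c.
  by exists (fun=> 0).
(* Diagonal intersection: [m] is only taken into account from level [m] on. *)
pose K (u : seq nat) := maxn (b u)
  (\max_(j < (size u).+1) \max_(m < (size u).+1) k (take j u, m : nat) u).
exists K => x y xs yt xK Cxy.
(* Obeying [b] keeps [x] on nodes without escape, where no move commits. *)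
have bx i : b (mkseq x (size s + i)) <= x (size s + i).
  by apply: leq_trans (xK _ (leq_addr _ _)); apply: leq_maxl.
have nEx i : ~ inhabited (escape t (mkseq x (size s + i))).
  elim: i => [|i IH]; first by rewrite addn0 xs.
  by rewrite addnS mkseqS; apply: (bP _ IH _ (bx i)).2.
(* The level [j] is at least [m], so from level [j.+1] on [K] dominates the bound for the node
   [mkseq x j.+1] and the term [m]. *)
pose m := y (size t); pose j := size s + m.
have av : avoidable (mkseq x j.+1) (rcons t m).
  apply: contrapT => nav; have [+ _] := bP _ (nEx m) _ (bx m).
  by apply; exists m; rewrite -mkseqS.
have := kP (mkseq x j.+1, m) av x y.
rewrite /fst /snd size_mkseq size_rcons => kx.
apply: kx Cxy => //; first by rewrite mkseqS yt.
move=> i lji; apply: leq_trans (xK i _); last first.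
  by apply: leq_trans (ltnW lji); apply: leq_addr.
apply: leq_trans (leq_maxr _ _).
have lj : j.+1 < (size (mkseq x i)).+1 by rewrite size_mkseq.
have lm : m < (size (mkseq x i)).+1.
  by rewrite size_mkseq ltnS (leq_trans _ (ltnW lji))// leq_addl.
apply: leq_trans (leq_bigmax (Ordinal lj)).
apply: leq_trans (leq_bigmax (Ordinal lm)) => /=.
suff -> : take j.+1 (mkseq x i) = mkseq x j.+1 by [].
by rewrite /mkseq -map_take take_iota (minn_idPl lji).
Qed.

Definition escape_of s t (nav : ~ avoidable s t) : escape t s :=
  inhabited_witness (unavoidable_escape s t nav).

Definition state := {p : seq nat * seq nat & escape p.2 p.1}.

Definition mkstate s t (d : escape t s) : state :=
  existT (fun p => escape p.2 p.1) (s, t) d.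

(** Committing takes precedence over continuing [d] and starts a fresh escape; [None] means leaving
    the tree. *)
Definition step_escape (t s : seq nat) (d : escape t s) (n : nat) : option state :=
  let: Escape N _ f := d in
  match pselect (commits s t n) with
  | left c => Some (mkstate _ _ (escape_of _ _ (svalP (cid c))))
  | right _ =>
    match pselect (N n) with
    | left Nn => Some (mkstate _ _ (f n Nn))
    | right _ => None
    end
  end.

Definition step (o : option state) (n : nat) : option state :=
  obind (fun z : state => step_escape _ _ (projT2 z) n) o.

Section Run.
Variable d0 : escape [::] [::].

Definition run (s : seq nat) : option state :=
  foldl step (Some (mkstate [::] [::] d0)) s.

Definition run_tree : set (seq nat) := [set s | run s].

Lemma run_rcons s n : run (rcons s n) = step (run s) n.
Proof. by rewrite /run -cats1 foldl_cat. Qed.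

Lemma run_tree_laver : laver run_tree.
Proof.
split; first split.
- by exists [::].
- move=> s _ /prefixP [t ->]; rewrite /run_tree /= /run foldl_cat.
  (* [None] is absorbing, so a run that survives [s] followed by [t] has survived [s]. *)
  by case: (foldl _ _ s) => // ; elim: t.
- move=> s; rewrite /run_tree /=.
  case E: (run s) => [[[s' t] d]|//] _; apply: unbounded_infinite => b.
  case: d E => /= N unb f E; have [n [lbn Hn]] := unb b; exists n; split=> //=.
  rewrite run_rcons E /=; case: pselect => // nc; case: pselect => // nN.
  by case: Hn.
Qed.

(** By induction on [d]: a move that does not commit passes to a smaller escape, so some later move
    commits. The equation on [s] keeps this index general in the induction. *)
Lemma run_progress (x : baire) : branches run_tree x ->
  forall t s (d : escape t s) n, s = mkseq x n ->
  run (mkseq x n) = Some (mkstate s t d) ->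
  exists n' m (d' : escape (rcons t m) (mkseq x n')),
    [/\ n < n', ~ avoidable (mkseq x n') (rcons t m) &
     run (mkseq x n') = Some (mkstate (mkseq x n') (rcons t m) d')].
Proof.
move=> bx t s d; elim: d => {}s N unb f IH n sE rE.
subst s; have := bx n.+1; rewrite /run_tree /= mkseqS run_rcons rE /=.
case: (pselect (commits _ _ _)) => c.
  move=> _; exists n.+1; rewrite mkseqS.
  exists (sval (cid c)), (escape_of _ _ (svalP (cid c))).
  split=> //; first exact: (svalP (cid c)).
  rewrite run_rcons rE /=; case: pselect => // c'.
  (* Equal proofs make [cid] choose the same term and the same escape. *)
  by have -> : c' = c by apply: Prop_irrelevance.
case: (pselect (N (x n))) => // Nx _.
have [|n' [m [d' [lnn' nav r']]]] := IH (x n) Nx n.+1 (esym (mkseqS _ _)).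
  rewrite mkseqS run_rcons rE /=; case: pselect => // _; case: pselect => // Nx'.
  by have -> : Nx' = Nx by apply: Prop_irrelevance.
by exists n', m, d'; split=> //; apply: ltnW.
Qed.

Lemma run_tree_branches : closed C -> branches run_tree `<=` fst @` C.
Proof.
move=> clC x bx.
pose reached (p : nat * seq nat) :=
  exists d, run (mkseq x p.1) = Some (mkstate (mkseq x p.1) p.2 d).
(* Bundling pairs with the proof that they are reached lets [F] be iterated. *)
have /choice [F FP] : forall p : {p | reached p}, exists q : {p | reached p},
    [/\ (sval p).1 < (sval q).1,
        exists m, (sval q).2 = rcons (sval p).2 m &
        ~ avoidable (mkseq x (sval q).1) (sval q).2].
  move=> -[[n t] [d dE]] /=.
  have [n' [m [d' [lnn' nav r']]]] := run_progress x bx t _ d n erefl dE.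
  by exists (exist reached (n', rcons t m) (ex_intro _ d' r')); split=> //; exists m.
have r0 : reached (0, [::]) by exists d0.
pose p j := sval (iter j F (exist reached (0, [::]) r0)).
have pS j : [/\ (p j).1 < (p j.+1).1, exists m, (p j.+1).2 = rcons (p j).2 m &
    ~ avoidable (mkseq x (p j.+1).1) (p j.+1).2] by apply: FP.
pose y : baire := fun j => last 0 (p j.+1).2.
have yE j : (p j).2 = mkseq y j.
  elim: j => [//|j IH]; rewrite mkseqS -IH /y.
  by have [_ [m ->] _] := pS j; rewrite last_rcons.
have lep j : j <= (p j).1.
  by elim: j => // j IH; have [lt _ _] := pS j; apply: leq_ltn_trans lt.
exists (x, y) => //; apply: closed_prefix_limit clC _ => j.
(* Stage [j.+1] is used because [pS] gives unavoidability only after a step; it fixes at least [j]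
   terms of both [x] and [y]. *)
have [_ _ /unavoidable_point] := pS j; rewrite yE !size_mkseq.
move=> [x' [y' [Cxy xE yE']]]; exists x', y'; split=> // i lij.
  have lt : i < (p j.+1).1 by apply: leq_trans (lep _); apply: ltnW.
  by have := congr1 (nth 0 ^~ i) xE; rewrite !nth_mkseq.
by have := congr1 (nth 0 ^~ i) yE'; rewrite !nth_mkseq// ltnW.
Qed.

End Run.

Lemma unavoidable_laver : closed C -> ~ avoidable [::] [::] ->
  exists2 L, laver L & branches L `<=` fst @` C.
Proof.
move=> clC /escape_of d; exists (run_tree d).
  exact: run_tree_laver.
exact: run_tree_branches.
Qed.

End Dichotomy.

Theorem theorem3 (A : set baire) (hA : analytic A) :
  (exists2 H : set (seq nat), hechler H & branches H `&` A = set0) \/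
  (exists2 L : set (seq nat), laver L & branches L `<=` A).
Proof.
have [C clC ->] := hA.
have [av|nav] := pselect (avoidable C [::] [::]).
  by left; apply: avoidable_hechler.
by right; apply: unavoidable_laver.
Qed.
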